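(* There is a family of self-adjoint elements $T(b)\in\mathbb R[\mathbf Z_2\wr\mathbf Z]$, indexed by $b\in(1,\infty)$, such that for every $b\in(1,\infty)$ the Novikov–Shubin invariant of $T(b)$ is $\alpha(T(b))=\frac{1}{2\log_2(b)}$, and such that for every $b\in\mathbb Q\cap(1,\infty)$ we have $T(b)\in\mathbb Q[\mathbf Z_2\wr\mathbf Z]$.
   Context: $\mathbf Z_2\wr\mathbf Z=\mathbf Z\ltimes\bigoplus_{\mathbb Z}\mathbf Z_2$ is the lamplighter group, with $\mathbf Z$ acting by shifting coordinates. For a countable discrete group $G$ and a self-adjoint $T\in\mathbb C[G]$ (with respect to the involution $(\sum a_g g)^*=\sum\overline{a_g}g^{-1}$), $T$ acts on $l^2(G)$ as a bounded self-adjoint operator, and $\mu_T$ denotes its spectral measure with respect to the vector $\delta_e\in l^2(G)$ (the indicator function of the neutral element), i.e. the probability measure on $\mathbb R$ with $\int s^n\,d\mu_T(s)=\langle T^n\delta_e,\delta_e\rangle$ for all $n\ge 0$. The Novikov–Shubin invariant of $T$ is $$\alpha(T):=\liminf_{\lambda\to0^+}\frac{\log(\mu_T((0,\lambda]))}{\log(\lambda)}\in[0,\infty].$$ *)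

(* Defs.v *)
From HB Require Import structures.
From mathcomp Require Import all_boot all_order all_algebra finmap complex.
From mathcomp Require Import monalg.
From mathcomp Require Import all_classical all_reals all_analysis.

Set Implicit Arguments.
Unset Strict Implicit.
Unset Printing Implicit Defensive.

Import Order.TTheory GRing.Theory Num.Theory numFieldNormedType.Exports.

Local Open Scope classical_set_scope.
Local Open Scope ring_scope.

(* monalg puts a ring structure on [{malg K[G]}] only when the monoid [G] has no
   nontrivial invertible element, which excludes groups; only its module
   structure on finitely supported functions [G -> K] is reused here. *)
Definition group_ring (K : nzRingType) (G : groupType) : Type := {malg K[G]}.

Section GroupRing.
Variables (K : nzRingType) (G : groupType).
Local Notation KG := (group_ring K G).
Implicit Types (f g h : KG) (x y : G).

HB.instance Definition _ := GRing.Lmodule.copy KG {malg K[G]}.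

Definition gr_one : KG := << 1%g >>.

Definition gr_mul f g : KG :=
  \sum_(x <- msupp f) \sum_(y <- msupp g) << f@_x * g@_y *g (x * y)%g >>.

Lemma gr_mulEw (d1 d2 : {fset G}) f g :
  (msupp f `<=` d1)%fset -> (msupp g `<=` d2)%fset ->
  gr_mul f g = \sum_(x <- d1) \sum_(y <- d2) << f@_x * g@_y *g (x * y)%g >>.
Proof.
move=> le1 le2; rewrite /gr_mul (big_fset_incl _ le1) /=.
  apply: eq_bigr => x _; apply/big_fset_incl => // y _ /mcoeff_outdom ->.
  by rewrite mulr0 monalgU0.
move=> x _ /mcoeff_outdom fx.
by rewrite big1 // => y _; rewrite fx mul0r monalgU0.
Qed.

Lemma grE f : f = \sum_(x <- msupp f) (<< f@_x *g x >> : KG).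
Proof. exact: (monalgE f). Qed.

Lemma gr_mul0r : left_zero (0 : KG) gr_mul.
Proof. by move=> g; rewrite /gr_mul msupp0 big_seq_fset0. Qed.

Lemma gr_mulr0 : right_zero (0 : KG) gr_mul.
Proof. by move=> g; rewrite /gr_mul exchange_big msupp0 big_seq_fset0. Qed.

Lemma gr_mulU a b x y :
  gr_mul << a *g x >> << b *g y >> = << a * b *g (x * y)%g >>.
Proof. by rewrite (gr_mulEw msuppU_le msuppU_le) !big_seq_fset1 !mcoeffUU. Qed.

Lemma gr_mulDl : left_distributive gr_mul +%R.
Proof.
move=> f g h; pose d := (msupp f `|` msupp g)%fset.
have sfg : (msupp (f + g) `<=` d)%fset by exact: msuppD_le.
rewrite (gr_mulEw sfg (fsubset_refl _)).
rewrite (gr_mulEw (fsubsetUl _ _ : msupp f `<=` d)%fset (fsubset_refl _)).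
rewrite (gr_mulEw (fsubsetUr _ _ : msupp g `<=` d)%fset (fsubset_refl _)).
rewrite -big_split /=; apply: eq_bigr => x _.
rewrite -big_split /=; apply: eq_bigr => y _.
by rewrite mcoeffD mulrDl monalgUD.
Qed.

Lemma gr_mulDr : right_distributive gr_mul +%R.
Proof.
move=> h f g; pose d := (msupp f `|` msupp g)%fset.
have sfg : (msupp (f + g) `<=` d)%fset by exact: msuppD_le.
rewrite (gr_mulEw (fsubset_refl _) sfg).
rewrite (gr_mulEw (fsubset_refl _) (fsubsetUl _ _ : msupp f `<=` d)%fset).
rewrite (gr_mulEw (fsubset_refl _) (fsubsetUr _ _ : msupp g `<=` d)%fset).
rewrite -big_split /=; apply: eq_bigr => x _.
rewrite -big_split /=; apply: eq_bigr => y _.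
by rewrite mcoeffD mulrDr monalgUD.
Qed.

Lemma gr_mul_suml I (r : seq I) (F : I -> KG) g :
  gr_mul (\sum_(i <- r) F i) g = \sum_(i <- r) gr_mul (F i) g.
Proof.
exact: (big_morph (gr_mul^~ g) (fun _ _ => gr_mulDl _ _ _) (gr_mul0r _)).
Qed.

Lemma gr_mul_sumr I (r : seq I) (F : I -> KG) g :
  gr_mul g (\sum_(i <- r) F i) = \sum_(i <- r) gr_mul g (F i).
Proof. exact: (big_morph (gr_mul g) (gr_mulDr g) (gr_mulr0 _)). Qed.

Lemma gr_mul1r : left_id gr_one gr_mul.
Proof.
move=> g; rewrite {1}(grE g) gr_mul_sumr [RHS]grE.
by apply: eq_bigr => x _; rewrite gr_mulU mul1r mul1g.
Qed.

Lemma gr_mulr1 : right_id gr_one gr_mul.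
Proof.
move=> g; rewrite {1}(grE g) gr_mul_suml [RHS]grE.
by apply: eq_bigr => x _; rewrite gr_mulU mulr1 mulg1.
Qed.

Lemma gr_mulA : associative gr_mul.
Proof.
move=> f g h; rewrite (grE f) !gr_mul_suml; apply: eq_bigr => x _.
rewrite (grE g) gr_mul_suml !gr_mul_sumr gr_mul_suml; apply: eq_bigr => y _.
rewrite (grE h) !gr_mul_sumr; apply: eq_bigr => z _.
by rewrite !gr_mulU mulrA mulgA.
Qed.

Lemma gr_one_neq0 : gr_one != 0.
Proof.
apply/eqP => /malgP /(_ 1%g) /eqP.
by rewrite mcoeffUU mcoeff0 oner_eq0.
Qed.

HB.instance Definition _ := GRing.Zmodule_isNzRing.Build KG
  gr_mulA gr_mul1r gr_mulr1 gr_mulDl gr_mulDr gr_one_neq0.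

End GroupRing.

Definition gr_map (K L : nzRingType) (G : groupType) (phi : K -> L)
    (f : group_ring K G) : group_ring L G :=
  [malg x in msupp f => phi f@_x].

Definition gr_star (C : numClosedFieldType) (G : groupType)
    (f : group_ring C G) : group_ring C G :=
  \sum_(x <- msupp f) << (f@_x)^* *g x^-1%g >>.

Definition gr_selfadjoint (C : numClosedFieldType) (G : groupType)
    (f : group_ring C G) : Prop :=
  gr_star f = f.

(* The inner product of l^2(G), restricted to finitely supported functions. *)
Definition gr_dot (C : numClosedFieldType) (G : groupType)
    (f g : group_ring C G) : C :=
  \sum_(x <- msupp f) f@_x * (g@_x)^*.

Definition gr_delta (C : numClosedFieldType) (G : groupType) (x : G) :
    group_ring C G :=
  << x >>.

(* The lamplighter group: pairs (m, f) with m in Z and f a finitely supported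
   function Z -> Z/2, multiplied by (m, f) (n, g) = (m + n, f + m.g), where
   (m.g) i = g (i - m). *)
Notation lamps := {malg 'Z_2[int]}.

Definition shift (m : int) (f : lamps) : lamps :=
  \sum_(i <- msupp f) << f@_i *g i + m >>.

Lemma shiftE m f i : (shift m f)@_i = f@_(i - m).
Proof.
rewrite [in RHS](monalgE f) /shift !raddf_sum /=; apply: eq_bigr => j _.
by rewrite !mcoeffU; congr (_ *+ _); rewrite (can2_eq (addrK m) (subrK m)).
Qed.

Lemma shiftD m f g : shift m (f + g) = shift m f + shift m g.
Proof. by apply/malgP => i; rewrite mcoeffD !shiftE mcoeffD. Qed.

Lemma shift_shift m n f : shift m (shift n f) = shift (m + n) f.
Proof. by apply/malgP => i; rewrite !shiftE opprD addrA. Qed.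

Lemma shift0z f : shift 0 f = f.
Proof. by apply/malgP => i; rewrite shiftE subr0. Qed.

Lemma shift0 m : shift m 0 = 0.
Proof. by apply/malgP => i; rewrite shiftE !mcoeff0. Qed.

Lemma shiftN m f : shift m (- f) = - shift m f.
Proof. by apply/malgP => i; rewrite mcoeffN !shiftE mcoeffN. Qed.

Definition lamplighter : Type := (int * lamps)%type.
HB.instance Definition _ := Choice.copy lamplighter (int * lamps)%type.

Definition lamplighter_one : lamplighter := (0, 0).
Definition lamplighter_mul (u v : lamplighter) : lamplighter :=
  (u.1 + v.1, u.2 + shift u.1 v.2).
Definition lamplighter_inv (u : lamplighter) : lamplighter :=
  (- u.1, - shift (- u.1) u.2).

Lemma lamplighter_mulA : associative lamplighter_mul.
Proof.
move=> [m f] [n g] [p h]; rewrite /lamplighter_mul /=.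
by rewrite shiftD shift_shift !addrA.
Qed.

Lemma lamplighter_mul1 : left_id lamplighter_one lamplighter_mul.
Proof. by move=> [m f]; rewrite /lamplighter_mul /= shift0z !add0r. Qed.

Lemma lamplighter_mulr1 : right_id lamplighter_one lamplighter_mul.
Proof. by move=> [m f]; rewrite /lamplighter_mul /= shift0 !addr0. Qed.

Lemma lamplighter_mulV : left_inverse lamplighter_one lamplighter_inv lamplighter_mul.
Proof. by move=> [m f]; rewrite /lamplighter_mul /= !addNr. Qed.

Lemma lamplighter_mulrV :
  right_inverse lamplighter_one lamplighter_inv lamplighter_mul.
Proof.
move=> [m f]; rewrite /lamplighter_mul /= shiftN shift_shift subrr shift0z.
by rewrite subrr.
Qed.

HB.instance Definition _ := isGroup.Build lamplighter
  lamplighter_mulA lamplighter_mul1 lamplighter_mulr1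
  lamplighter_mulV lamplighter_mulrV.

(* [mu] is the spectral measure of [T] at delta_e.  Since [T] is finitely
   supported, T^n delta_e stays in C[G], where [T] acts by left multiplication.
   The moments determine [mu] because [T] is a bounded operator on l^2(G). *)
Definition is_spectral_measure (R : realType) (G : groupType)
    (T : group_ring R[i] G) (mu : probability (measurableTypeR R) R) : Prop :=
  forall n : nat,
    mu.-integrable setT (fun s : R => (s ^+ n)%:E) /\
    ((\int[mu]_s (s ^+ n))%R%:C)%C
      = gr_dot (T ^+ n * gr_delta _ 1%g) (gr_delta _ 1%g).

(* As [lne 0 = -oo] and [ln l < 0] for [l] near 0, the quotient is [+oo] where
   [mu `]0, l] = 0]. *)
Definition novikov_shubin (R : realType)
    (mu : probability (measurableTypeR R) R) : \bar R :=
  limf_einf (fun l : R => lne (mu `]0%R, l]%classic) / (ln l)%:E)%E 0^'+.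

Definition has_novikov_shubin (R : realType) (G : groupType)
    (T : group_ring R[i] G) (a : \bar R) : Prop :=
  exists mu : probability (measurableTypeR R) R,
    is_spectral_measure T mu /\ novikov_shubin mu = a.

Definition log2 (R : realType) (b : R) : R := ln b / ln 2.

(* Main.v *)
(** T(b) = A* A with A = 1 + b t p, where t is the generator of Z and
    p = (1 + a)/2 with a the lamp at 0.  Under Fourier duality on the lamps, p
    is the indicator of the configurations in {0,1}^Z that vanish at 0, and t
    shifts.  A random configuration therefore cuts Z into intervals; the density
    of intervals with k + 1 points is 2^-(k+2), and on such an interval A acts
    as A_k = 1 + b J_k with J_k a nilpotent Jordan block.  Hence the spectral
    measure is
      mu = sum_k 2^-(k+2) sum_(d eigenvalue of A_k^T A_k) delta_d.
    The sum of the inverse eigenvalues of A_k^T A_k is the squared Frobenius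
    norm of A_k^-1, whose entries are (-b)^(i-j), so up to factors polynomial in
    k the smallest eigenvalue is b^(-2k).  Thus mu (0, b^(-2k)] is 2^-k up to
    such factors, that is, mu (0, x] behaves like x^(1/(2 log2 b)). *)

Require Import Defs.
From HB Require Import structures.
From mathcomp Require Import all_boot all_order all_algebra finmap complex.
From mathcomp Require Import monalg.
From mathcomp Require Import all_classical all_reals all_analysis.
From mathcomp Require Import measurable_realfun.
From mathcomp Require Import ring lra zify.

Import Order.TTheory GRing.Theory Num.Theory numFieldNormedType.Exports.

Local Open Scope ring_scope.

Set Implicit Arguments.
Unset Strict Implicit.
Unset Printing Implicit Defensive.

(** * Coefficients in group rings *)

(* Locked, since unification otherwise unfolds the monomials to finite maps. *)
HB.lock Definition gr_of (K : nzRingType) (G : groupType) (x : G) :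
  group_ring K G := << x >>.
Canonical gr_of_unlockable := Unlockable gr_of.unlock.

Lemma sum_msupp_eq (K : nzRingType) (G : choiceType) (V : zmodType)
  (f : {malg K[G]}) (F : G -> V) x : (f@_x = 0 -> F x = 0) ->
  \sum_(z <- msupp f) F z *+ (z == x) = F x.
Proof.
case: msuppP => [xf _|xf ->//].
  rewrite (big_fsetD1 _ xf) /= eqxx mulr1n big1_fset ?addr0 // => z.
  by rewrite in_fsetD1 => /andP[/negPf zx _] _; rewrite zx mulr0n.
by rewrite big_seq big1 // => z zf; case: eqP xf => // <-; rewrite zf.
Qed.

Section GroupRingCoefficients.
Variables (K : nzRingType) (G : groupType).
Implicit Types (f g : group_ring K G) (x y z : G) (c : K).

(** Terms off the support vanish, so the convolution may run over any larger finite set [d]. This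
    allows for supports that shrink under scaling or under a ring morphism. *)
Lemma mcoeff_grMw (d : {fset G}) f g x : (msupp f `<=` d)%fset ->
  (f * g)@_x = \sum_(y <- d) f@_y * g@_(y^-1 * x)%g.
Proof.
move=> fd; rewrite -[f * g]/(gr_mul f g) (gr_mulEw fd (fsubset_refl _)).
rewrite raddf_sum /=; apply: eq_bigr => y _; rewrite raddf_sum /=.
under eq_bigr => z _ do rewrite mcoeffU (can2_eq (mulKg y) (mulVKg y)).
by rewrite sum_msupp_eq // => ->; rewrite mulr0.
Qed.

Lemma mcoeff_grM f g x :
  (f * g)@_x = \sum_(y <- msupp f) f@_y * g@_(y^-1 * x)%g.
Proof. exact: mcoeff_grMw. Qed.

Lemma gr_scalerAl c f g : (c *: f) * g = c *: (f * g).
Proof.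
apply/malgP => x; rewrite mcoeffZ (mcoeff_grMw _ _ (msuppZ_le c f)) mcoeff_grM.
by rewrite mulr_sumr; apply: eq_bigr => y _; rewrite mcoeffZ mulrA.
Qed.

Lemma gr_ofM x y : gr_of K x * gr_of K y = gr_of K (x * y)%g.
Proof. by rewrite unlock [LHS]gr_mulU mul1r. Qed.

Lemma gr_of1 : gr_of K (1%g : G) = 1.
Proof. by rewrite unlock. Qed.

Lemma mcoeff_ofM x f y : (gr_of K x * f)@_y = f@_(x^-1 * y)%g.
Proof.
by rewrite unlock (mcoeff_grMw _ _ msuppU_le) big_seq_fset1 mcoeffUU mul1r.
Qed.

Lemma mcoeff_Mof x f y : (f * gr_of K x)@_y = f@_(y * x^-1)%g.
Proof.
rewrite unlock mcoeff_grM.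
have eqz z : (x == z^-1 * y)%g = (z == y * x^-1)%g.
  by apply/eqP/eqP => ->; rewrite invgM invgK ?mulVKg ?mulgVK.
under eq_bigr => z _ do rewrite mcoeffU mulr_natr eqz.
by rewrite sum_msupp_eq.
Qed.

Lemma mcoeff_of x y : (gr_of K x)@_y = (x == y)%:R.
Proof. by rewrite unlock mcoeffU. Qed.

Lemma mcoeff_gr1 x : (1 : group_ring K G)@_x = (x == 1%g)%:R.
Proof. by rewrite -gr_of1 mcoeff_of eq_sym. Qed.

End GroupRingCoefficients.

Lemma gr_scalerAr (K : comNzRingType) (G : groupType) (c : K)
  (f g : group_ring K G) : f * (c *: g) = c *: (f * g).
Proof.
apply/malgP => x; rewrite mcoeffZ !mcoeff_grM mulr_sumr.
by apply: eq_bigr => y _; rewrite mcoeffZ mulrCA.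
Qed.

Section GroupRingMap.
Variables (K L : nzRingType) (G : groupType) (phi : {rmorphism K -> L}).
Implicit Types (f g : group_ring K G) (x : G).

Lemma mcoeff_gr_map f x : (gr_map phi f)@_x = phi f@_x.
Proof. by rewrite mcoeffE; case: msuppP => // _; rewrite rmorph0. Qed.

Lemma gr_mapD f g : gr_map phi (f + g) = gr_map phi f + gr_map phi g.
Proof. by apply/malgP => x; rewrite mcoeffD !mcoeff_gr_map mcoeffD rmorphD. Qed.

Lemma gr_mapZ c f : gr_map phi (c *: f) = phi c *: gr_map phi f.
Proof. by apply/malgP => x; rewrite mcoeffZ !mcoeff_gr_map mcoeffZ rmorphM. Qed.

Lemma gr_map_of x : gr_map phi (gr_of K x) = gr_of L x.
Proof.
by apply/malgP => y; rewrite mcoeff_gr_map !mcoeff_of rmorph_nat.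
Qed.

Lemma gr_mapM f g : gr_map phi (f * g) = gr_map phi f * gr_map phi g.
Proof.
apply/malgP => x; rewrite mcoeff_gr_map mcoeff_grM rmorph_sum.
rewrite (@mcoeff_grMw _ _ (msupp f)); last first.
  apply/fsubsetP => y; rewrite -!mcoeff_neq0 mcoeff_gr_map.
  by apply: contraNneq => ->; rewrite rmorph0.
by apply: eq_bigr => y _; rewrite rmorphM !mcoeff_gr_map.
Qed.

Lemma gr_mapX f n : gr_map phi (f ^+ n) = gr_map phi f ^+ n.
Proof.
elim: n => [|n IHn]; first by rewrite !expr0 -!gr_of1 gr_map_of.
by rewrite !exprS gr_mapM IHn.
Qed.

End GroupRingMap.

Lemma mcoeff_gr_star (C : numClosedFieldType) (G : groupType)
  (f : group_ring C G) x : (gr_star f)@_x = (f@_(x^-1)%g)^*.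
Proof.
rewrite /gr_star raddf_sum /=.
under eq_bigr => z _ do rewrite mcoeffU (can2_eq invgK invgK).
by rewrite sum_msupp_eq // => ->; rewrite conjC0.
Qed.

Lemma gr_dot_delta (C : numClosedFieldType) (G : groupType)
  (f : group_ring C G) x : gr_dot f (gr_delta C x) = f@_x.
Proof.
rewrite /gr_dot /gr_delta.
under eq_bigr => z _ do rewrite mcoeffU rmorphMn rmorph1 mulr_natr eq_sym.
by rewrite sum_msupp_eq.
Qed.

(** The l^1 norm of one factor times the supremum norm of the other. Truncation errors are bounded
    this way, with a constant that depends on [f] alone. *)
Lemma mcoeff1_grM_le (K : numDomainType) (G : groupType) (f g : group_ring K G)
  (e : K) : (forall x, `|g@_x| <= e) ->
  `|(f * g)@_1%g| <= (\sum_(x <- msupp f) `|f@_x|) * e.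
Proof.
move=> ge; rewrite mcoeff_grM mulr_suml; apply: le_trans (ler_norm_sum _ _ _) _.
by apply: ler_sum => x _; rewrite normrM ler_wpM2l.
Qed.

(** * The group ring of the lamplighter group *)

Definition translation (m : int) : lamplighter := (m, 0).
Definition lamp (i : int) : lamplighter := (0, << i >>).

Lemma lamplighterM m f n g :
  (((m, f) : lamplighter) * ((n, g) : lamplighter))%g =
  (m + n, f + Defs.shift m g) :> lamplighter.
Proof. by []. Qed.

Lemma translationM m n :
  (translation m * translation n)%g = translation (m + n).
Proof. by rewrite lamplighterM Defs.shift0 addr0. Qed.

Lemma translationV m : ((translation m)^-1)%g = translation (- m).
Proof. by congr pair; rewrite /= Defs.shift0 oppr0. Qed.

Lemma shiftU m (a : 'Z_2) i : Defs.shift m << a *g i >> = << a *g i + m >>.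
Proof.
by apply/malgP => j; rewrite Defs.shiftE !mcoeffU (can2_eq (addrK m) (subrK m)).
Qed.

Lemma translation_lamp m i :
  (translation m * lamp i)%g = (lamp (i + m) * translation m)%g.
Proof.
rewrite !lamplighterM shiftU Defs.shift0z !addr0 [in RHS]add0r.
by rewrite [X in (_, X)]add0r.
Qed.

Lemma lampC i j : (lamp i * lamp j)%g = (lamp j * lamp i)%g.
Proof. by rewrite !lamplighterM !Defs.shift0z [X in (_, X)]addrC. Qed.

Lemma lampK i : (lamp i * lamp i)%g = 1%g.
Proof.
rewrite lamplighterM Defs.shift0z addr0.
suff -> : << i >> + << i >> = 0 :> lamps by [].
apply/malgP => j.
rewrite mcoeffD mcoeffU mcoeff0 -mulrnDl.
by apply/eqP; case: (i == j).
Qed.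

Lemma lampV i : ((lamp i)^-1)%g = lamp i.
Proof. by apply: (mulgI (lamp i)); rewrite mulgV lampK. Qed.

Lemma lampM2 i g j : (lamp i * g)%g.2@_j = (i == j)%:R + g.2@_j.
Proof. by rewrite /= Defs.shift0z mcoeffD mcoeffU. Qed.

(** In a pattern, [true] prescribes the value 1 at a cell and [false] the value 0. The [k] zeros
    between the ones at [1] and [- k] give [k + 1] translates, by [0] to [k], which are the points
    of one interval. *)
Definition block (k : nat) : seq (int * bool) :=
  (1, true) :: rcons [seq (- m%:Z, false) | m <- iota 0 k] (- k%:Z, true).

Definition right_zeros (j : nat) : seq (int * bool) :=
  [seq (j%:Z - m%:Z, false) | m <- iota 0 j].

Definition left_zeros (i : nat) : seq (int * bool) :=
  [seq (- m%:Z, false) | m <- iota 0 i].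

Lemma right_zerosS j : right_zeros j.+1 = (j.+1%:Z, false) :: right_zeros j.
Proof.
rewrite /right_zeros /= subr0 -[1%N]/(1 + 0)%N iotaDl -map_comp.
by congr cons; apply: eq_map => m /=; congr pair; lia.
Qed.

Lemma left_zerosS i : left_zeros i.+1 = rcons (left_zeros i) (- i%:Z, false).
Proof. by rewrite /left_zeros -addn1 iotaD map_cat cats1. Qed.

(** The translate splits at the origin: its nearest one strictly to the right sits at [j + 1], its
    nearest one at or left of the origin at [- i]. *)
Lemma block_shift i j :
  [seq (x.1 + j%:Z, x.2) | x <- block (i + j)] =
  ((j.+1%:Z, true) :: right_zeros j) ++ rcons (left_zeros i) (- i%:Z, true).
Proof.
rewrite /= map_rcons -rcons_cat; congr (_ :: rcons _ _).
- rewrite -map_comp addnC iotaD map_cat; congr cat.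
    by rewrite /right_zeros; apply: eq_map => m /=; congr pair; lia.
  rewrite /left_zeros (addnC 0 j) iotaDl -map_comp; apply: eq_map => m /=.
  by congr pair; lia.
- by congr pair; rewrite /=; lia.
Qed.

Lemma mem_block k m : (m < k)%N -> (- m%:Z, false) \in block k.
Proof.
move=> mk; rewrite inE mem_rcons inE.
by rewrite (map_f (fun m : nat => (- m%:Z, false))) ?orbT // mem_iota.
Qed.

Definition jordan_mx (K : nzRingType) k : 'M[K]_k.+1 :=
  \matrix_(i, j) (i == j.+1 :> nat)%:R.

Definition factor_mx (K : nzRingType) (b : K) k : 'M[K]_k.+1 :=
  1 + b *: jordan_mx K k.

Definition block_gram (K : nzRingType) (b : K) k : 'M[K]_k.+1 :=
  (factor_mx b k)^T * factor_mx b k.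

(** * Cylinder projections and the invariant subspaces they generate *)

Section Cylinders.
Variables (K : numFieldType) (A : algType K) (tr x : int -> A).
Hypotheses (tr0 : tr 0 = 1) (trD : forall m n, tr m * tr n = tr (m + n)).
Hypothesis tr_x : forall m i, tr m * x i = x (i + m) * tr m.
Hypothesis xC : forall i j, x i * x j = x j * x i.
Hypothesis xK : forall i, x i * x i = 1.
Implicit Types (i j m : int) (e : bool) (s : seq (int * bool)).

(** The idempotent [p] for the lamp at [i]. Only the relations between translations and lamps enter,
    so the operator identities are proved in an arbitrary algebra. *)
Definition off i : A := 2^-1 *: (1 + x i).

Lemma tr_off m i : tr m * off i = off (i + m) * tr m.
Proof. by rewrite -scalerAr -scalerAl mulrDr mulrDl tr_x mulr1 mul1r. Qed.

Lemma offC i j : off i * off j = off j * off i.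
Proof.
rewrite -!scalerAl -!scalerAr !mulrDl !mulrDr !mul1r !mulr1.
by rewrite xC addrACA.
Qed.

Lemma offK i : off i * off i = off i.
Proof.
rewrite -scalerAl -scalerAr mulrDl mul1r mulrDr mulr1 xK [x i + 1]addrC.
rewrite -mulr2n -[(1 + x i) *+ 2]scaler_nat !scalerA -mulrA.
by rewrite mulVf ?mulr1 ?pnatr_eq0.
Qed.

(* Under Fourier duality, the group ring of the lamps acts by multiplication
   operators on functions on [{0,1}^Z]; [cyl s] is the indicator of the cylinder
   of all sequences whose [i]-th term is [e] for every [(i, e)] in [s]. *)
Definition cyl1 i e : A := if e then 1 - off i else off i.
Definition cyl s : A := \prod_(y <- s) cyl1 y.1 y.2.

(** [cyl1 i e] is the eigenprojection of the involution [x i] for the eigenvalue [(-1) ^+ e]. This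
    form yields coefficients by recursion on the pattern. *)
Lemma cyl1M i e f :
  cyl1 i e * f = 2^-1 *: (f + (-1) ^+ e *: (x i * f)).
Proof.
have offM : off i * f = 2^-1 *: (f + x i * f).
  by rewrite -scalerAl mulrDl mul1r.
case: e; last by rewrite expr0 scale1r.
rewrite expr1 scaleN1r mulrBl mul1r offM !scalerDr scalerN opprD addrA.
congr (_ - _); rewrite -[X in X - _]scale1r -scalerBl; congr (_ *: _).
by field.
Qed.

Lemma tr_cyl1 m i e : tr m * cyl1 i e = cyl1 (i + m) e * tr m.
Proof. by case: e; rewrite /= ?tr_off // mulrBl mulrBr mulr1 mul1r tr_off. Qed.

Lemma tr_cyl m s : tr m * cyl s = cyl [seq (y.1 + m, y.2) | y <- s] * tr m.
Proof.
rewrite /cyl; elim: s => [|y s IHs] /=; first by rewrite !big_nil mulr1 mul1r.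
by rewrite !big_cons mulrA tr_cyl1 -!mulrA IHs.
Qed.

Lemma cyl1C i j e e' : cyl1 i e * cyl1 j e' = cyl1 j e' * cyl1 i e.
Proof.
have offBC h k : off h * (1 - off k) = (1 - off k) * off h.
  by rewrite mulrBl mulrBr mulr1 mul1r offC.
case: e e' => [] []; rewrite /cyl1;
  [|exact/esym/offBC|exact: offBC|exact: offC].
by rewrite mulrBl mul1r offBC mulrBr mulr1.
Qed.

Lemma cyl1K i e : cyl1 i e * cyl1 i e = cyl1 i e.
Proof.
case: e => /=; last exact: offK.
by rewrite mulrBl mul1r mulrBr mulr1 offK subrr subr0.
Qed.

Lemma cyl1N i e : cyl1 i e * cyl1 i (~~ e) = 0.
Proof.
by case: e; rewrite /= ?mulrBl ?mulrBr ?mulr1 ?mul1r offK subrr.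
Qed.

Lemma cyl1_cyl i e s : cyl1 i e * cyl s = cyl s * cyl1 i e.
Proof.
rewrite /cyl; elim: s => [|y s IHs]; first by rewrite big_nil mulr1 mul1r.
by rewrite big_cons mulrA cyl1C -!mulrA IHs.
Qed.

Lemma cyl_cons i e s : cyl ((i, e) :: s) = cyl1 i e * cyl s.
Proof. by rewrite /cyl big_cons. Qed.

Lemma cyl_cat s s' : cyl (s ++ s') = cyl s * cyl s'.
Proof. by rewrite /cyl big_cat. Qed.

Lemma cyl_rcons i e s : cyl (rcons s (i, e)) = cyl s * cyl1 i e.
Proof. by rewrite -cats1 cyl_cat cyl_cons /cyl big_nil mulr1. Qed.

Lemma cyl_mem i e s : (i, e) \in s -> cyl1 i e * cyl s = cyl s.
Proof.
case/splitPr => s1 s2; rewrite cyl_cat cyl_cons mulrA cyl1_cyl -!mulrA.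
by congr (_ * _); rewrite mulrA cyl1K.
Qed.

Lemma cyl_memN i e s : (i, ~~ e) \in s -> cyl1 i e * cyl s = 0.
Proof.
case/splitPr => s1 s2; rewrite cyl_cat cyl_cons mulrA cyl1_cyl -!mulrA.
by rewrite [X in _ * X]mulrA cyl1N mul0r mulr0.
Qed.

Definition op_factor (b : K) : A := 1 + b *: (tr 1 * off 0).
(** The algebra carries no involution at this point, so the adjoint of [op_factor b] is written
    out. *)
Definition op_factor_adj (b : K) : A := 1 + b *: (off 0 * tr (-1)).
Definition op_T (b : K) : A := op_factor_adj b * op_factor b.

Lemma op_TE b : op_T b =
  1 + b *: (tr 1 * off 0) + b *: (off 0 * tr (-1)) + b ^+ 2 *: off 0.
Proof.
rewrite /op_T /op_factor_adj mulrDl mul1r {1}/op_factor mulrDr mulr1 addrA.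
congr (_ + _); rewrite -scalerAl -scalerAr scalerA; congr (_ *: _).
by rewrite mulrA -[off 0 * _ * _]mulrA trD addNr tr0 mulr1 offK.
Qed.

Definition block_vec k (j : 'I_k.+1) : A := tr j%:Z * cyl (block k).

(** Moving [off 0] past the translation tests the pattern at cell [- j]. For [j < k] the cell is 0
    and the next vector results; for [j = k] it is 1 and the product vanishes. *)
Lemma shift_block_vec k (j : 'I_k.+1) : tr 1 * off 0 * block_vec j =
  \sum_i jordan_mx K k i j *: block_vec i.
Proof.
have -> : tr 1 * off 0 * block_vec j =
    tr j.+1%:Z * (cyl1 (- j%:Z) false * cyl (block k)).
  rewrite /block_vec -mulrA [off 0 * _]mulrA -{1}(addNr j%:Z) -tr_off.
  by rewrite -!mulrA mulrA trD -intS.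
have [jk|kj] := ltnP j k.
  rewrite cyl_mem; last exact: mem_block.
  rewrite (bigD1 (Ordinal (jk : j.+1 < k.+1)%N)) //= big1 ?addr0 => [|i ij].
    by rewrite mxE eqxx scale1r.
  by rewrite mxE -val_eqE /= in ij *; rewrite (negPf ij) scale0r.
have jE : j = k :> nat by apply/eqP; rewrite eqn_leq -ltnS ltn_ord.
rewrite cyl_memN ?mulr0; last by rewrite inE mem_rcons jE inE eqxx orbT.
rewrite big1 // => i _; rewrite mxE jE.
by rewrite (ltn_eqF (ltn_ord i)) scale0r.
Qed.

(** Here the tested cell is [1 - j], which carries a one exactly for [j = 0]. The chain is thus run
    backwards, which transposes the matrix. *)
Lemma unshift_block_vec k (j : 'I_k.+1) : off 0 * tr (-1) * block_vec j =
  \sum_i (jordan_mx K k)^T i j *: block_vec i.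
Proof.
have -> : off 0 * tr (-1) * block_vec j =
    tr (j%:Z - 1) * (cyl1 (1 - j%:Z) false * cyl (block k)).
  rewrite /block_vec [off 0 * _ * _]mulrA -[off 0 * _ * _]mulrA trD.
  by rewrite [_ + j%:Z]addrC mulrA tr_off -addrA addKr subrr.
case: j => [[|j] jk]; rewrite [nat_of_ord _]/=.
  rewrite subr0 cyl_memN ?mulr0 ?inE ?eqxx // big1 // => i _.
  by rewrite !mxE scale0r.
rewrite cyl_mem; last by rewrite intS opprD addNKr mem_block.
rewrite (bigD1 (Ordinal (ltnW jk : j < k.+1)%N)) //= big1 ?addr0 => [|i ij].
  by rewrite !mxE eqxx scale1r intS addrAC subrr add0r.
by rewrite !mxE -val_eqE /= in ij *; rewrite eqSS eq_sym (negPf ij) scale0r.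
Qed.

Definition acts_by k (f : A) (X : 'M[K]_k.+1) :=
  forall j : 'I_k.+1, f * block_vec j = \sum_i X i j *: block_vec i.

Lemma acts_by1 k : acts_by 1 (1 : 'M[K]_k.+1).
Proof.
move=> j; rewrite mul1r (bigD1 j) //= big1 ?addr0 => [|i ij].
  by rewrite mxE eqxx scale1r.
by rewrite mxE (negPf ij) scale0r.
Qed.

Lemma acts_byD k f g (X Y : 'M[K]_k.+1) c :
  acts_by f X -> acts_by g Y -> acts_by (f + c *: g) (X + c *: Y).
Proof.
move=> fX gY j; rewrite mulrDl fX -scalerAl gY scaler_sumr -big_split /=.
by apply: eq_bigr => i _; rewrite !mxE scalerDl scalerA.
Qed.

Lemma acts_byM k f g (X Y : 'M[K]_k.+1) :
  acts_by f X -> acts_by g Y -> acts_by (f * g) (X * Y).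
Proof.
move=> fX gY j; rewrite -mulrA gY mulr_sumr.
under eq_bigr => i _ do rewrite -scalerAr fX scaler_sumr.
rewrite exchange_big; apply: eq_bigr => i _; rewrite mxE scaler_suml.
by apply: eq_bigr => l _; rewrite scalerA mulrC.
Qed.

Lemma acts_by_op_T k (b : K) n : acts_by (op_T b ^+ n) (block_gram b k ^+ n).
Proof.
elim: n => [|n IHn]; first exact: acts_by1.
rewrite !exprS; apply: acts_byM => //; apply: acts_byM.
  rewrite /factor_mx linearD linearZ /= tr_scalar_mx.
  exact: acts_byD (@acts_by1 k) (@unshift_block_vec k).
exact: acts_byD (@acts_by1 k) (@shift_block_vec k).
Qed.

(** Configurations are sorted by their nearest one strictly right of the origin, at [j + 1], and
    their nearest one at or left of it, at [- i]. With [p] and [q] the projections onto [N] zeros on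
    the right and on the left, the sum is [(1 - p) * (1 - q)], and the remainder is
    [p + q - p * q]. *)
Lemma cyl_partition N :
  1 = \sum_(i < N) \sum_(j < N) tr j%:Z * cyl (block (i + j)) * tr (- j%:Z) +
      (cyl (right_zeros N) + cyl (left_zeros N)
       - cyl (right_zeros N ++ left_zeros N)).
Proof.
have -> : \sum_(i < N) \sum_(j < N)
      tr j%:Z * cyl (block (i + j)) * tr (- j%:Z) =
    (1 - cyl (right_zeros N)) * (1 - cyl (left_zeros N)).
  (* Splitting according to the value at the next cell telescopes into a sum over the position of
     the first one. *)
  have -> : 1 - cyl (right_zeros N) =
      \sum_(j < N) cyl ((j.+1%:Z, true) :: right_zeros j).
    elim: N => [|N IHN]; first by rewrite /cyl !big_nil big_ord0 subrr.
    rewrite big_ord_recr -IHN /= right_zerosS !cyl_cons /cyl1 mulrBl mul1r.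
    by rewrite addrA subrK.
  have -> : 1 - cyl (left_zeros N) =
      \sum_(i < N) cyl (rcons (left_zeros i) (- i%:Z, true)).
    elim: N => [|N IHN]; first by rewrite /cyl !big_nil big_ord0 subrr.
    rewrite big_ord_recr -IHN /= left_zerosS !cyl_rcons /cyl1 mulrBr mulr1.
    by rewrite addrA subrK.
  rewrite mulr_suml exchange_big; apply: eq_bigr => j _.
  rewrite mulr_sumr; apply: eq_bigr => i _.
  by rewrite tr_cyl -mulrA trD subrr tr0 mulr1 block_shift cyl_cat.
rewrite cyl_cat mulrBl mul1r mulrBr mulr1.
set p := cyl (right_zeros N); set q := cyl (left_zeros N).
by rewrite -[1 - q - _]addrA -opprD [p + q]addrC -[q + p - _]addrA subrK.
Qed.

End Cylinders.

(** * Coefficients of cylinders in the lamplighter group ring *)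

HB.instance Definition _ (K : comNzRingType) (G : groupType) :=
  GRing.Lmodule_isLalgebra.Build K (group_ring K G)
    (fun c f g => esym (gr_scalerAl c f g)).
HB.instance Definition _ (K : comNzRingType) (G : groupType) :=
  GRing.Lalgebra_isAlgebra.Build K (group_ring K G)
    (fun c f g => esym (gr_scalerAr c f g)).

Section LampRing.
Variable K : numFieldType.
Local Notation KL := (group_ring K lamplighter).

Definition gtr (m : int) : KL := gr_of K (translation m).
Definition glamp (i : int) : KL := gr_of K (lamp i).
Local Notation gcyl1 := (@cyl1 K KL glamp).
Local Notation gcyl := (@cyl K KL glamp).

Lemma gtr0 : gtr 0 = 1.
Proof. exact: gr_of1. Qed.

Lemma gtrD m n : gtr m * gtr n = gtr (m + n).
Proof. by rewrite gr_ofM translationM. Qed.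

Lemma gtr_lamp m i : gtr m * glamp i = glamp (i + m) * gtr m.
Proof. by rewrite /gtr /glamp !gr_ofM translation_lamp. Qed.

Lemma glampC i j : glamp i * glamp j = glamp j * glamp i.
Proof. by rewrite /glamp !gr_ofM lampC. Qed.

Lemma glampK i : glamp i * glamp i = 1.
Proof. by rewrite /glamp gr_ofM lampK gr_of1. Qed.

Lemma mcoeff_cyl1M i e (f : KL) g :
  (gcyl1 i e * f)@_g = 2^-1 * (f@_g + (-1) ^+ e * f@_(lamp i * g)%g).
Proof. by rewrite cyl1M mcoeffZ mcoeffD mcoeffZ mcoeff_ofM lampV. Qed.

Lemma cyl_supp s g : (gcyl s)@_g != 0 ->
  g.1 = 0 /\ forall i, i \notin map fst s -> g.2@_i = 0.
Proof.
elim: s g => [|[i e] s IHs] g.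
  rewrite /cyl big_nil mcoeff_gr1; case: (g =P 1%g) => [-> _|_].
    by split=> // i _; rewrite mcoeff0.
  by rewrite eqxx.
rewrite cyl_cons mcoeff_cyl1M => nz.
have [g0|/IHs[g1 g2]] := eqVneq (gcyl s)@_g 0; last first.
  by split=> // j; rewrite inE negb_or => /andP[_]; exact: g2.
have [ig0|/IHs[g1 g2]] := eqVneq (gcyl s)@_(lamp i * g)%g 0.
  by rewrite g0 ig0 mulr0 addr0 mulr0 eqxx in nz.
split=> [|j]; first by rewrite -g1 /= add0r.
rewrite inE negb_or => /andP[ji js]; have := g2 _ js.
by rewrite lampM2 eq_sym (negPf ji) add0r.
Qed.

(** [g] and [lamp i * g] differ at the cell [i] outside the pattern, where elements of the support
    have no lamp. So at most one of the two lies in the support. *)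
Lemma cyl_notin i s g : i \notin map fst s ->
  (gcyl s)@_g = 0 \/ (gcyl s)@_(lamp i * g)%g = 0.
Proof.
move=> si; have [->|/cyl_supp[_ g2]] := eqVneq (gcyl s)@_g 0; first by left.
have [->|/cyl_supp[_ ig2]] := eqVneq (gcyl s)@_(lamp i * g)%g 0; first by right.
by move: (ig2 i si); rewrite lampM2 g2 // eqxx => /eqP.
Qed.

(** Each new cell halves the coefficients, and by [cyl_notin] no two of them add up. In Fourier
    terms, the coefficients of an indicator are bounded by the measure of its set. *)
Lemma mcoeff_cyl_le s g : uniq (map fst s) -> `|(gcyl s)@_g| <= 2^-1 ^+ size s.
Proof.
elim: s g => [|[i e] s IHs] g.
  by rewrite /cyl big_nil mcoeff_gr1 expr0 normr_nat lern1 leq_b1.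
rewrite [uniq _]/= => /andP[si us]; rewrite cyl_cons mcoeff_cyl1M exprS normrM.
rewrite ger0_norm ?invr_ge0 ?ler0n // ler_wpM2l ?invr_ge0 ?ler0n //.
case: (cyl_notin g si) => ->; last by rewrite mulr0 addr0 IHs.
by rewrite add0r normrM normrX normrN1 expr1n mul1r IHs.
Qed.

Lemma mcoeff1_cyl s : uniq (map fst s) -> (gcyl s)@_1%g = 2^-1 ^+ size s.
Proof.
elim: s => [|[i e] s IHs]; first by rewrite /cyl big_nil mcoeff_gr1 eqxx.
rewrite [uniq _]/= => /andP[si us]; rewrite cyl_cons mcoeff_cyl1M exprS IHs //.
(* The first alternative contradicts the induction hypothesis, whose right-hand side is nonzero. *)
case: (cyl_notin 1%g si) => [|->]; last by rewrite mulr0 addr0.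
by rewrite IHs // => /eqP; rewrite expf_eq0 invr_eq0 pnatr_eq0 andbF.
Qed.

End LampRing.

Lemma uniq_block k : uniq (map fst (block k)).
Proof.
rewrite /= map_rcons /= -map_comp -[rcons _ _]/(rcons (map _ _) _).
have -> :
    rcons [seq (fst \o (fun m : nat => (- m%:Z, false))) i | i <- iota 0 k]
      (- k%:Z) = [seq - m%:Z | m <- iota 0 k.+1].
  by rewrite -[in RHS]addn1 iotaD map_cat cats1.
rewrite map_inj_uniq ?iota_uniq ?andbT; last by move=> m n /oppr_inj [].
by apply/mapP => -[m _]; lia.
Qed.

Lemma uniq_zeros i j : uniq (map fst (right_zeros j ++ left_zeros i)).
Proof.
rewrite map_cat -!map_comp cat_uniq !map_inj_uniq ?iota_uniq ?andbT /=.
- apply/hasPn => _ /mapP[m _ ->]; apply/mapP => -[l].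
  by rewrite mem_iota /=; lia.
- by move=> m n /=; lia.
- by move=> m n /=; lia.
Qed.

Lemma size_block k : size (block k) = k.+2.
Proof. by rewrite /= size_rcons size_map size_iota. Qed.

Definition lampT (K : numFieldType) (b : K) : group_ring K lamplighter :=
  op_T (gtr K) (glamp K) b.

(** The power of [lampT b] expands into the vectors [tr i * cyl (block k)]. After multiplication by
    [tr (- j)] only [i = j] has trivial translation part, and it contributes the measure of a
    cylinder with [k + 2] prescribed cells. *)
Lemma mcoeff1_block (K : numFieldType) (b : K) n k (j : 'I_k.+1) :
  (lampT b ^+ n * (gtr K j%:Z * cyl (glamp K) (block k) * gtr K (- j%:Z)))@_1%g
  = 2^-1 ^+ k.+2 * (block_gram b k ^+ n) j j.
Proof.
rewrite mulrA.
have := acts_by_op_T (gtrD K) (gtr_lamp K) (glampC K) (glampK K) (k := k) b n j.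
rewrite /block_vec /lampT => ->.
rewrite mulr_suml raddf_sum /=.
have blockE (i : 'I_k.+1) :
    (gtr K i%:Z * cyl (glamp K) (block k) * gtr K (- j%:Z))@_1%g =
    2^-1 ^+ k.+2 *+ (i == j).
  rewrite mcoeff_Mof mcoeff_ofM mul1g !translationV opprK translationM.
  have [->|ij] := eqVneq i j.
    rewrite addNr; have := mcoeff1_cyl K (uniq_block k).
    by rewrite size_block.
  apply/eqP; apply: contraNT ij => /cyl_supp[/= /eqP].
  by rewrite addrC subr_eq0 eq_sym => /eqP[/val_inj ->].
under eq_bigr => i _ do rewrite gr_scalerAl mcoeffZ blockE.
rewrite (bigD1 j) //= big1 ?addr0 => [|i /negPf ->]; last by rewrite mulr0.
by rewrite eqxx mulrC.
Qed.

(** The element is built from [b] by field operations, so one formula serves over the rational, real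
    and complex numbers. *)
Lemma gr_map_lampT (K L : numFieldType) (phi : {rmorphism K -> L}) (b : K) :
  gr_map phi (lampT b) = lampT (phi b).
Proof.
have map1 : gr_map phi (1 : group_ring K lamplighter) = 1.
  by rewrite -gr_of1 gr_map_of gr_of1.
have mapoff : gr_map phi (off (glamp K) 0) = off (glamp L) 0.
  rewrite gr_mapZ fmorphV rmorph_nat; congr (_ *: _).
  by rewrite gr_mapD map1 gr_map_of.
rewrite gr_mapM; congr (_ * _); rewrite gr_mapD map1 gr_mapZ.
  by congr (_ + _ *: _); rewrite gr_mapM mapoff gr_map_of.
by congr (_ + _ *: _); rewrite gr_mapM mapoff gr_map_of.
Qed.

(** * The involution and self-adjointness *)

Section Star.
Variables (C : numClosedFieldType) (G : groupType).
Implicit Types (f g : group_ring C G) (x : G).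

Lemma gr_starD f g : gr_star (f + g) = gr_star f + gr_star g.
Proof.
by apply/malgP => x; rewrite mcoeffD !mcoeff_gr_star mcoeffD rmorphD.
Qed.

Lemma gr_starZ c f : gr_star (c *: f) = c^* *: gr_star f.
Proof.
by apply/malgP => x; rewrite mcoeffZ !mcoeff_gr_star mcoeffZ rmorphM.
Qed.

Lemma gr_starK f : gr_star (gr_star f) = f.
Proof. by apply/malgP => x; rewrite !mcoeff_gr_star invgK conjCK. Qed.

Lemma gr_star_of x : gr_star (gr_of C x) = gr_of C (x^-1)%g.
Proof.
apply/malgP => y; rewrite mcoeff_gr_star !mcoeff_of rmorph_nat.
by rewrite (can2_eq invgK invgK).
Qed.

Lemma gr_star_ofM x f : gr_star (gr_of C x * f) = gr_star f * gr_of C (x^-1)%g.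
Proof.
apply/malgP => y.
by rewrite mcoeff_Mof !mcoeff_gr_star mcoeff_ofM invgM invgK.
Qed.

End Star.

Lemma lampT_selfadjoint (C : numClosedFieldType) (b : C) :
  b^* = b -> gr_selfadjoint (lampT b).
Proof.
move=> bR; have offs : gr_star (off (glamp C) 0) = off (glamp C) 0.
  rewrite /off gr_starZ gr_starD -gr_of1 !gr_star_of invg1 lampV.
  by rewrite fmorphV rmorph_nat.
have troffs :
    gr_star (gtr C 1 * off (glamp C) 0) = off (glamp C) 0 * gtr C (-1).
  by rewrite gr_star_ofM translationV offs.
rewrite /gr_selfadjoint /lampT (op_TE (gtr0 C) (gtrD C) (glampK C)).
have star1 : gr_star (1 : group_ring C lamplighter) = 1.
  by rewrite -gr_of1 gr_star_of invg1.
(* The involution exchanges the two middle terms of [op_TE] and fixes the outer ones; this is stated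
   for an arbitrary additive map. *)
have swap (V : zmodType) (f : V -> V) I X Y Z : {morph f : u v / u + v} ->
    f I = I -> f X = Y -> f Y = X -> f Z = Z ->
    f (I + X + Y + Z) = I + X + Y + Z.
  by move=> fD fI fX fY fZ; rewrite !fD fI fX fY fZ [I + Y + X]addrAC.
apply: swap (@gr_starD _ _) star1 _ _ _; rewrite gr_starZ.
- by rewrite bR troffs.
- by rewrite bR -troffs gr_starK.
- by rewrite offs rmorphXn /= bR.
Qed.

(** Contribution to the [n]-th moment of the configurations whose interval around the origin ends
    within [N] steps on both sides. *)
Definition rect_moment (K : numFieldType) (b : K) n N : K :=
  \sum_(i < N) \sum_(j < N)
    2^-1 ^+ (i + j).+2 * (block_gram b (i + j) ^+ n) (inord j) (inord j).

(** By [cyl_partition] the error comes from three cylinders with [N], [N] and [2 * N] prescribed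
    cells, whose coefficients are at most [2^-1 ^+ N]. Hence [c] is three times the l^1 norm of
    [lampT b ^+ n]. *)
Lemma rect_moment_approx (K : numFieldType) (b : K) n : exists2 c, 0 <= c &
  forall N, `|(lampT b ^+ n)@_1%g - rect_moment b n N| <= c * 2^-1 ^+ N.
Proof.
exists (\sum_(x <- msupp (lampT b ^+ n)) `|(lampT b ^+ n)@_x| * 3).
  by apply: sumr_ge0 => x _; rewrite mulr_ge0.
move=> N; pose cylK := cyl (glamp K).
pose rest := cylK (right_zeros N) + cylK (left_zeros N)
  - cylK (right_zeros N ++ left_zeros N).
have -> : (lampT b ^+ n)@_1%g - rect_moment b n N = (lampT b ^+ n * rest)@_1%g.
  rewrite -{1}[lampT b ^+ n]mulr1.
  rewrite (cyl_partition (gtr0 K) (gtrD K) (gtr_lamp K) N) mulrDr mcoeffD.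
  rewrite addrAC -[RHS]add0r; congr (_ + _); apply/eqP; rewrite subr_eq0.
  apply/eqP; rewrite mulr_sumr raddf_sum /=; apply: eq_bigr => i _.
  rewrite mulr_sumr raddf_sum /=; apply: eq_bigr => j _.
  have jE : (inord j : 'I_(i + j).+1) = j :> nat.
    by rewrite inordK // ltnS leq_addl.
  by rewrite -mcoeff1_block jE.
rewrite -mulr_suml -mulrA; apply: mcoeff1_grM_le => x.
have le0 s : uniq (map fst s) -> (N <= size s)%N ->
    `|(cylK s)@_x| <= 2^-1 ^+ N.
  move=> us Ns; apply: le_trans (mcoeff_cyl_le _ _ us) _.
  by rewrite ler_wiXn2l // ?invr_ge0 ?ler0n // invf_le1 ?ltr0n // ler1n.
have uz := uniq_zeros N N.
have szr : size (right_zeros N) = N by rewrite size_map size_iota.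
have szl : size (left_zeros N) = N by rewrite size_map size_iota.
have := uz; rewrite map_cat cat_uniq => /and3P[ur _ ul].
rewrite mcoeffB mcoeffD.
rewrite (_ : 3 * _ = 2^-1 ^+ N + 2^-1 ^+ N + 2^-1 ^+ N); last by ring.
apply: le_trans (ler_normB _ _) _; apply: lerD.
  apply: le_trans (ler_normD _ _) _.
  by apply: lerD; apply: le0 => //; rewrite ?szr ?szl.
by apply: le0 => //; rewrite size_cat szr leq_addr.
Qed.

(** * The spectra of the blocks *)

Lemma conj_diag_mxX (F : fieldType) k (P : 'M[F]_k.+1) (s : 'rV_k.+1) n :
  P \in unitmx -> (invmx P *m diag_mx s *m P) ^+ n =
  invmx P *m diag_mx (\row_i s 0 i ^+ n) *m P.
Proof.
move=> Pu; elim: n => [|n IHn].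
  rewrite expr0 [diag_mx (\row_i _)](_ : _ = 1%:M).
    by rewrite mulmx1 mulVmx.
  by apply/matrixP => i j; rewrite !mxE expr0.
rewrite exprS IHn -[LHS]/(_ *m _) !mulmxA mulmxK //; congr (_ *m _).
rewrite -mulmxA; congr (_ *m _).
by apply/matrixP => i j; rewrite mul_diag_mx !mxE exprS mulrnAr.
Qed.

Section SingularValues.
Local Open Scope sesquilinear_scope.
Variables (R : realType) (k : nat) (A N : 'M[R]_k.+1).
Hypothesis AN : A * N = 1.
Local Notation C := R[i].
Local Notation toC := (map_mx (real_complex R)).

Lemma singular_values : exists d : 'I_k.+1 -> R,
  [/\ forall i, 0 < d i,
      forall n, \tr ((A^T * A) ^+ n) = \sum_i d i ^+ n &
      \sum_i (d i)^-1 = \sum_i \sum_j N i j ^+ 2].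
Proof.
pose M : 'M[C]_k.+1 := toC (A^T * A).
have Mherm : M \is hermsymmx.
  apply: realsym_hermsym.
    apply/is_hermitianmxP; rewrite expr0 scale1r map_mx_id //.
    by rewrite /M map_trmx trmx_mul trmxK.
  apply/(@mxOverP _ _ _ Num.real M) => i j; rewrite mxE.
  by apply/complex_realP; exists ((A^T * A) i j).
have Mspec := orthomx_spectralP (hermitian_normalmx Mherm).
pose P := spectralmx M; pose sp := spectral_diag M.
have Pu : P \in unitmx := spectral_unit M.
have Pinv : invmx P = P^t* := invmx_unitary (spectral_unitarymx M).
have DE : diag_mx sp = P *m M *m invmx P.
  by rewrite [in RHS]Mspec !mulmxA mulmxV // mul1mx mulmxK.
have spreal i : sp 0 i = (complex.Re (sp 0 i))%:C%C.
  have := hermitian_spectral_diag_real Mherm.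
  move=> /(@mxOverP _ _ _ Num.real sp)/(_ 0 i)/complex_realP[x xE].
  by rewrite -/sp in xE; rewrite xE.
(* Each eigenvalue is a diagonal entry of the Gram matrix of [A *m P^t*], hence a sum of squared
   moduli. *)
have sp_ge0 i : 0 <= sp 0 i.
  have -> : sp 0 i = (((toC A *m P^t*)^t*) *m (toC A *m P^t*)) i i.
    have -> : (toC A *m P^t*)^t* = P *m toC A^T.
      rewrite trmx_mul map_mxM trmxCK; congr (_ *m _).
      by apply/matrixP => r l; rewrite !mxE; exact: conjc_real.
    rewrite mulmxA -[_ *m toC A^T *m _]mulmxA -map_mxM -Pinv -DE.
    by rewrite mxE eqxx.
  rewrite mxE; apply: sumr_ge0 => j _.
  by rewrite !mxE mulrC mul_conjC_ge0.
(* The inverse of [A^T * A] in the eigenbasis; its diagonal lists the inverse eigenvalues. *)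
pose X := P *m toC (N *m N^T) *m invmx P.
have DX : diag_mx sp *m X = 1%:M.
  rewrite DE /X !mulmxA mulmxKV // -[P *m _ *m _]mulmxA -map_mxM !mulmxA.
  rewrite -[A^T *m A *m N]mulmxA [A *m N]AN mulmx1 -trmx_mul.
  have -> : N *m A = 1%:M by exact: mulmx1C.
  by rewrite trmx1 map_mx1 mulmx1 mulmxV.
have spX i : sp 0 i * X i i = 1.
  by have /matrixP/(_ i i) := DX; rewrite mul_diag_mx !mxE eqxx.
have sp_neq0 i : sp 0 i != 0.
  by apply: contra_eq_neq (spX i) => ->; rewrite mul0r eq_sym oner_eq0.
exists (fun i => complex.Re (sp 0 i)); split=> [i|n|].
- by rewrite -ltcR -spreal lt_def sp_neq0 sp_ge0.
- apply: (@complexI R); rewrite [RHS]rmorph_sum.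
  under [RHS]eq_bigr => i _ do rewrite rmorphXn /= -spreal.
  rewrite -trace_map_mx (_ : map_mx _ _ = M ^+ n); last exact: rmorphXn.
  rewrite [in LHS]Mspec -/P -/sp conj_diag_mxX //.
  rewrite mxtrace_mulC mulmxA mulmxV // mul1mx mxtrace_diag.
  by apply: eq_bigr => i _; rewrite mxE.
- apply: (@complexI R); rewrite rmorph_sum.
  under eq_bigr => i _.
    rewrite fmorphV /= -spreal -[_^-1]mulr1 -(spX i) mulKf //.
    over.
  rewrite -[LHS]/(\tr X) mxtrace_mulC mulmxA mulVmx // mul1mx trace_map_mx.
  congr (_%:C)%C; apply: eq_bigr => i _; rewrite mxE.
  by apply: eq_bigr => j _; rewrite mxE expr2.
Qed.

End SingularValues.

Section BlockSpectrum.
Variables (R : realType) (b : R).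
Hypothesis b1 : 1 < b.

Let b0 : 0 < b := lt_trans ltr01 b1.

(** The sum of the inverse eigenvalues lies between [b ^+ (2 * k)] and [(k + 1)^2] times that. The
    upper bound holds for each term, the lower one for some term after averaging. *)
Lemma block_eigenvalues k : exists d : 'I_k.+1 -> R,
  [/\ forall i, 0 < d i,
      forall n, \tr (block_gram b k ^+ n) = \sum_i d i ^+ n,
      forall i, (d i)^-1 <= k.+1%:R ^+ 2 * b ^+ (2 * k) &
      exists i, b ^+ (2 * k) / k.+1%:R <= (d i)^-1].
Proof.
(* The inverse of [1 + b J], from the finite geometric series in the nilpotent [- b J]. *)
pose N : 'M[R]_k.+1 :=
  \matrix_(i, j) (if (j <= i)%N then (- b) ^+ (i - j) else 0).
have AN : factor_mx b k * N = 1.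
  apply/matrixP => i j; rewrite /factor_mx mulrDl mul1r -scalerAl !mxE.
  case: i => -[|i] ik.
    rewrite big1 => [|l _]; last by rewrite mxE /= mul0r.
    by rewrite mulr0 addr0 /= leqn0 sub0n eq_sym -val_eqE /=; case: eqP.
  rewrite (bigD1 (Ordinal (ltnW ik))) //= big1 => [|l li]; last first.
    by rewrite mxE eqSS eq_sym -val_eqE /= in li *; rewrite (negPf li) mul0r.
  rewrite !mxE /= eqxx mul1r addr0 -val_eqE /=.
  case: ltngtP => ij.
  - by rewrite -ltnS ij subSn // exprS mulNr addNr.
  - by rewrite leqNgt (ltnW ij) mulr0 addr0.
  - by rewrite ij ltnn subnn mulr0 addr0.
have [d [d0 trd sumd]] := singular_values AN.
have sqrX m : ((- b) ^+ m) ^+ 2 = b ^+ (2 * m).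
  by rewrite exprAC sqrrN -exprM.
(* The entry of [N] in the last row and first column alone gives this bound. *)
have sumN_ge : b ^+ (2 * k) <= \sum_i (d i)^-1.
  rewrite sumd (bigD1 ord_max) //= (bigD1 ord0) //= mxE leq0n subn0.
  rewrite sqrX -addrA lerDl addr_ge0 ?sumr_ge0 // => i _.
    exact: sqr_ge0.
  by rewrite sumr_ge0 // => j _; exact: sqr_ge0.
have sumN_le : \sum_i (d i)^-1 <= k.+1%:R ^+ 2 * b ^+ (2 * k).
  rewrite sumd.
  apply: (@le_trans _ _ (\sum_(i < k.+1) \sum_(j < k.+1) b ^+ (2 * k))).
    apply: ler_sum => i _; apply: ler_sum => j _; rewrite mxE.
    case: ifP => _; last by rewrite expr0n exprn_ge0 // ltW.
    rewrite sqrX ler_eXn2l //.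
    by rewrite leq_mul2l /= (leq_trans (leq_subr _ _)) // -ltnS.
  rewrite !sumr_const card_ord -[leLHS]mulr_natl -[X in _ * X]mulr_natl.
  by rewrite mulrA expr2.
exists d; split => //.
- move=> i; apply: le_trans sumN_le.
  rewrite (bigD1 i) //= lerDl sumr_ge0 // => j _.
  by rewrite invr_ge0 ltW.
- apply/not_existsP => small.
  move: sumN_ge; rewrite leNgt => /negP; apply.
  apply: (@lt_le_trans _ _ (\sum_(i < k.+1) b ^+ (2 * k) / k.+1%:R)).
    apply: ltr_sum => [|i _]; last by rewrite ltNge; exact/negP/small.
    by apply/hasP; exists ord0; rewrite ?mem_index_enum.
  by rewrite sumr_const card_ord -[leLHS]mulr_natr divfK ?pnatr_eq0.
Qed.

(** All entries of [1 + b J] are nonnegative. Truncated moments can therefore be compared by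
    inclusion of their index sets. *)
Lemma block_gram_ge0 k n i j : 0 <= (block_gram b k ^+ n) i j.
Proof.
have A_ge0 r l : 0 <= factor_mx b k r l.
  by rewrite !mxE addr_ge0 ?ler0n // mulr_ge0 ?ler0n // ltW.
elim: n i j => [|n IHn] i j; first by rewrite mxE ler0n.
rewrite exprS mxE sumr_ge0 // => l _.
rewrite mulr_ge0 // mxE sumr_ge0 // => r _.
by rewrite mxE mulr_ge0.
Qed.

Definition block_moment n k : R := 2^-1 ^+ k.+2 * \tr (block_gram b k ^+ n).

Lemma block_moment_ge0 n k : 0 <= block_moment n k.
Proof.
rewrite mulr_ge0 ?exprn_ge0 ?invr_ge0 ?ler0n // sumr_ge0 // => i _.
exact: block_gram_ge0.
Qed.

Lemma sum_triangle (f : nat -> nat -> R) N :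
  \sum_(0 <= k < N) \sum_(0 <= j < k.+1) f (k - j)%N j =
  \sum_(0 <= j < N) \sum_(0 <= i < N - j) f i j.
Proof.
elim: N => [|N IHN]; first by rewrite !big_geq.
rewrite big_nat_recr //= IHN [RHS]big_nat_recr //= subSnn big_nat1.
rewrite [X in _ + X]big_nat_recr //= subnn addrA; congr (_ + _).
rewrite -big_split /=; apply: eq_big_nat => j /andP[_ jN].
by rewrite subSn ?(ltnW jN) // big_nat_recr.
Qed.

(** The triangle [i + j < N] lies in the square of side [N], which lies in the triangle
    [i + j < N + N]. *)
Lemma sum_block_moment_rect n N :
  \sum_(0 <= k < N) block_moment n k <= rect_moment b n N
    <= \sum_(0 <= k < N + N) block_moment n k.
Proof.
pose f i j : R :=
  2^-1 ^+ (i + j).+2 * (block_gram b (i + j) ^+ n) (inord j) (inord j).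
have f_ge0 i j : 0 <= f i j.
  by rewrite mulr_ge0 ?block_gram_ge0 ?exprn_ge0 ?invr_ge0 ?ler0n.
have momentE k : block_moment n k = \sum_(0 <= j < k.+1) f (k - j)%N j.
  rewrite /block_moment mulr_sumr big_mkord; apply: eq_bigr => j _.
  by rewrite /f subnK ?inord_val // -ltnS.
have rectE : rect_moment b n N = \sum_(0 <= j < N) \sum_(0 <= i < N) f i j.
  rewrite /rect_moment exchange_big /= big_mkord; apply: eq_bigr => j _.
  by rewrite big_mkord.
have le_tail m p j : (m <= p)%N ->
    \sum_(0 <= i < m) f i j <= \sum_(0 <= i < p) f i j.
  by move=> mp; rewrite (big_cat_nat (leq0n m) mp) /= lerDl sumr_ge0.
rewrite !(eq_bigr _ (fun k _ => momentE k)) !sum_triangle rectE.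
apply/andP; split.
  by apply: ler_sum => j _; apply: le_tail; rewrite leq_subr.
rewrite [leRHS](big_cat_nat (leq0n N) (leq_addr N N)) /=.
apply: (@le_trans _ _ (\sum_(0 <= j < N) \sum_(0 <= i < N + N - j) f i j)).
  rewrite !big_nat; apply: ler_sum => j /andP[_ jN]; apply: le_tail.
  by rewrite -addnBA ?leq_addr // ltnW.
by rewrite lerDl sumr_ge0 // => j _; rewrite sumr_ge0.
Qed.

Local Open Scope classical_set_scope.

(** The square sums tend to the coefficient, and the triangular sums [s] increase and are bounded.
    Squeezing the squares between [s N] and [s (N + N)] identifies the two limits. *)
Lemma cvg_sum_block_moment n :
  (\sum_(0 <= k < N) block_moment n k) @[N --> \oo] --> (lampT b ^+ n)@_1%g.
Proof.
set t := (lampT b ^+ n)@_1%g; pose s N := \sum_(0 <= k < N) block_moment n k.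
have [c c0 approx] := rect_moment_approx b n.
have rect_t : rect_moment b n @ \oo --> t.
  apply/subr_cvg0; apply/norm_cvg0P.
  apply: (@squeeze_cvgr _ _ _ _ (fun=> 0) (fun N => c * 2^-1 ^+ N)).
  - by near=> N; rewrite normr_ge0 /= distrC approx.
  - exact: cvg_cst.
  - rewrite -[X in _ --> X](mulr0 c); apply: cvgMr.
    apply: cvg_expr; rewrite ger0_norm ?invr_ge0 ?ler0n //.
    by rewrite invf_lt1 ?ltr1n.
have s_nd : nondecreasing_seq s.
  apply/nondecreasing_seqP => N.
  by rewrite /s big_nat_recr //= lerDl block_moment_ge0.
have s_le N : s N <= `|t| + c.
  have /andP[+ _] := sum_block_moment_rect n N; move/le_trans; apply.
  apply: le_trans (ler_norm _) _; rewrite -[X in `|X|](subKr t).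
  apply: le_trans (ler_normB _ _) _; rewrite lerD2l.
  apply: le_trans (approx N) _.
  by rewrite ler_piMr // exprn_ile1 ?invr_ge0 ?ler0n // invf_le1 ?ltr0n ?ler1n.
have s_cvg : s @ \oo --> limn s.
  apply: nondecreasing_is_cvgn => //; exists (`|t| + c) => _ [N _ <-].
  exact: s_le.
have s2_cvg : s (N + N)%N @[N --> \oo] --> limn s.
  apply: (cvg_comp (fun N => (N + N)%N) s _ s_cvg).
  by under [X in X @ _]funext => N do rewrite addnn -mul2n; exact: cvg_mulnl.
have rect_s : rect_moment b n @ \oo --> limn s.
  apply: squeeze_cvgr s_cvg s2_cvg.
  by near=> N; exact: sum_block_moment_rect.
by rewrite (cvg_unique _ rect_t rect_s).
Unshelve. all: by end_near. Qed.

End BlockSpectrum.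

(** * Atomic measures *)

Section AtomicMeasure.
Variables (R : realType) (w : nat -> {nonneg R}) (size_ : nat -> nat)
  (atom : nat -> nat -> R).
Local Open Scope classical_set_scope.
Local Open Scope ereal_scope.

Local Notation T := (measurableTypeR R).

Definition atomic_block (k : nat) : {measure set T -> \bar R} :=
  mscale (w k) (msum (fun l => @dirac _ T (atom k l) R) (size_ k)).

Definition atomic_measure : {measure set T -> \bar R} := mseries atomic_block 0.

Lemma ge0_integral_atomic (g : T -> \bar R) :
  measurable_fun (setT : set T) g -> (forall x, 0 <= g x) ->
  \int[atomic_measure]_x g x =
  \sum_(0 <= k <oo) ((w k)%:num%:E * \sum_(l < size_ k) g (atom k l)).
Proof.
move=> mg g0; rewrite ge0_integral_measure_series //.
apply: eq_eseriesr => k _; rewrite ge0_integral_mscale //; congr (_ * _).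
rewrite ge0_integral_measure_sum //; apply: eq_bigr => l _.
by rewrite integral_dirac // diracT mul1e.
Qed.

Lemma atomic_measureE (A : set T) : atomic_measure A =
  \sum_(0 <= k <oo)
    ((w k)%:num * \sum_(l < size_ k) (atom k l \in A)%:R)%:E.
Proof.
rewrite -[LHS]/(\sum_(0 <= k <oo) atomic_block k A).
by apply: eq_eseriesr => k _; rewrite EFinM -sumEFin.
Qed.

Hypothesis atom_gt0 : forall k l, (l < size_ k)%N -> (0 < atom k l)%R.

Lemma atomic_moment (m : nat) (t : R) :
  (\sum_(0 <= k < N) (w k)%:num * \sum_(l < size_ k) atom k l ^+ m)%R
    @[N --> \oo] --> t ->
  atomic_measure.-integrable setT (fun s : R => (s ^+ m)%:E) /\
  (\int[atomic_measure]_s (s ^+ m))%R = t.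
Proof.
move=> cvgt.
have mX : measurable_fun (setT : set T) (fun s : R => (s ^+ m)%:E : \bar R).
  by apply/measurable_EFinP; exact: measurable_funX.
(* All atoms are positive, so only the values of [g] on positive numbers matter. This applies to
   both the absolute value and the positive part of the power. *)
have sumE (g : T -> \bar R) :
    measurable_fun (setT : set T) g -> (forall x, 0 <= g x) ->
    (forall x : R, (0 < x)%R -> g x = (x ^+ m)%:E) ->
    \int[atomic_measure]_x g x = t%:E.
  move=> mg g0 gX; rewrite ge0_integral_atomic //; apply/cvg_lim => //.
  rewrite (_ : (fun N => _) = EFin \o (fun N =>
    (\sum_(0 <= k < N) (w k)%:num * \sum_(l < size_ k) atom k l ^+ m)%R)).
    by apply/cvg_EFin => //; exact: nearW.
  apply/funext => N /=; rewrite -sumEFin; apply: eq_bigr => k _.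
  rewrite EFinM -sumEFin; congr (_ * _); apply: eq_bigr => l _.
  by rewrite gX // atom_gt0.
have intX : atomic_measure.-integrable setT (fun s : R => (s ^+ m)%:E).
  apply/integrableP; split => //.
  rewrite (sumE (fun s => `|(s ^+ m)%:E|)) ?ltry // => [|x x0].
    exact: measurableT_comp.
  by rewrite gee0_abs // lee_fin exprn_ge0 // ltW.
split => //; rewrite /Rintegral integralE.
rewrite (sumE _ (measurable_funepos mX)) //; last first.
  move=> x x0; rewrite funeposE; apply/max_idPl.
  by rewrite lee_fin exprn_ge0 // ltW.
rewrite ge0_integral_atomic //; last exact: measurable_funeneg.
rewrite eseries0 ?sube0 // => k _ _; rewrite big1 ?mule0 // => l _.
rewrite funenegE; apply/max_idPr.
by rewrite leeNl oppe0 lee_fin exprn_ge0 // ltW // atom_gt0.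
Qed.

End AtomicMeasure.

(** * The Novikov-Shubin invariant *)

Section NovikovShubin.
Variable R : realType.
Implicit Types (r s x : R).
Local Open Scope classical_set_scope.
Local Open Scope ereal_scope.

Lemma lne_quotient_ge r s x : (0 < x < 1)%R -> (r <= expR (s * ln x))%R ->
  s%:E <= lne r%:E / (ln x)%:E.
Proof.
move=> x01 rs; have lnx := ln_lt0 x01.
have [r0|r0] := leP r 0%R.
  (* Here [lne r] is [-oo], and division by the negative [ln x] gives [+oo]. *)
  rewrite le0_lneNy ?lee_fin // lt0_mulNye ?leey // inver lt_eqF //.
  by rewrite lte_fin invr_lt0.
rewrite lne_EFin // inver lt_eqF // -EFinM lee_fin ler_ndivlMr //.
by rewrite -[leRHS]expRK ler_ln ?posrE ?expR_gt0.
Qed.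

Lemma lne_quotient_le r s x : (0 < x < 1)%R -> (expR (s * ln x) <= r)%R ->
  lne r%:E / (ln x)%:E <= s%:E.
Proof.
move=> x01 rs; have lnx := ln_lt0 x01.
have r0 : (0 < r)%R := lt_le_trans (expR_gt0 _) rs.
rewrite lne_EFin // inver lt_eqF // -EFinM lee_fin ler_ndivrMr //.
by rewrite -[leLHS]expRK ler_ln ?posrE ?expR_gt0.
Qed.

(** Division by [ln x < 0] reverses inequalities, so upper bounds on the mass bound the quotient
    from below. For a lower limit these must hold for all small [x], whereas the opposite bounds are
    required only at arbitrarily small [x]. *)
Lemma novikov_shubin_eq (mu : probability (measurableTypeR R) R) (a : R) :
  (forall s, (s < a)%R -> exists2 d, (0 < d)%R & forall x, (0 < x < d)%R ->
     mu `]0%R, x]%classic <= (expR (s * ln x))%:E) ->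
  (forall s, (a < s)%R -> forall d, (0 < d)%R -> exists2 x, (0 < x < d)%R &
     (expR (s * ln x))%:E <= mu `]0%R, x]%classic) ->
  novikov_shubin mu = a%:E.
Proof.
move=> ub lb.
have muE x : mu `]0%R, x]%classic = (fine (mu `]0%R, x]%classic))%:E.
  by rewrite fineK // fin_num_measure.
apply/eqP; rewrite eq_le /novikov_shubin limf_einfE; apply/andP; split.
- apply/lee_addgt0Pr => e e0; apply: ge_ereal_sup => _ [V V0 <-].
  have [d d0 dV] : exists2 d : R, (0 < d)%R & forall x, (0 < x < d)%R -> V x.
    move/nbhs_ballP: V0 => [d /= d0 dV]; exists d => // x /andP[x0 xd].
    by apply: dV => //; rewrite /ball /= sub0r normrN gtr0_norm.
  have d1 : (0 < Num.min d 1)%R by rewrite lt_min d0 ltr01.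
  have ae : (a < a + e)%R by rewrite ltrDl.
  have [x] := lb _ ae _ d1.
  rewrite lt_min => /and3P[x0 xd x1] lbx; apply: ge_ereal_inf.
  exists (lne (mu `]0%R, x]%classic) / (ln x)%:E).
    by exists x => //; apply: dV; rewrite x0.
  rewrite muE -EFinD; apply: lne_quotient_le; first by rewrite x0.
  by rewrite -lee_fin -muE.
- apply/lee_subgt0Pr => e e0; rewrite -EFinB.
  have ae : (a - e < a)%R by rewrite ltrBlDr ltrDl.
  have [d d0 ubd] := ub _ ae.
  apply: le_trans (ereal_sup_ubound _); last first.
    (* The cap at 1 keeps [ln x] negative. *)
    exists `]0%R, Num.min d 1%R[%classic; last by [].
    near=> x; rewrite /= in_itv /=; apply/andP; split => //.
    by near: x; apply: nbhs_right_lt; rewrite lt_min d0 ltr01.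
  apply: le_ereal_inf_tmp => _ [x + <-].
  rewrite /= in_itv /= lt_min => /and3P[x0 xd x1].
  rewrite muE; apply: lne_quotient_ge; first by rewrite x0.
  by rewrite -lee_fin -muE ubd // x0.
Unshelve. all: by end_near. Qed.

End NovikovShubin.

(** * Exponential rates against polynomial factors in [k] *)

Section Growth.
Variables (R : realType) (b : R).
Hypothesis b1 : 1 < b.
Implicit Types (s e : R) (k : nat).

Let b0 : 0 < b := lt_trans ltr01 b1.
Let lnb : 0 < ln b := ln_gt0 b1.

(** This is [ln y <= y] at [y = e * (k + 1)]: polynomial factors cost an arbitrarily small
    exponential rate. *)
Lemma ln_natS_le e k : 0 < e -> ln k.+1%:R <= e * k.+1%:R - ln e.
Proof.
move=> e0; rewrite lerBrDl -lnM ?posrE ?ltr0n //.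
by rewrite ltW // ln_sublinear // mulr_gt0 // ltr0n.
Qed.

Lemma half_expE k : 2^-1 ^+ k = expR (- (k%:R * ln 2)) :> R.
Proof. by rewrite expRN mulrC expRM_natr lnK ?posrE // exprVn. Qed.

Lemma ln_block_bound k :
  ln (k.+1%:R ^+ 2 * b ^+ (2 * k)) = 2 * ln k.+1%:R + 2 * k%:R * ln b.
Proof.
rewrite lnM ?posrE ?exprn_gt0 ?ltr0n // !lnXn ?ltr0n //.
by rewrite -[_ *+ 2]mulr_natl -[ln b *+ _]mulr_natl natrM.
Qed.

Lemma tail_le_geometric s : 0 < s -> 2 * s * ln b < ln 2 ->
  exists C q : R, [/\ 0 < C, 0 < q < 1 & forall k,
    2^-1 ^+ k.+2 * (k.+1%:R * expR (s * ln (k.+1%:R ^+ 2 * b ^+ (2 * k))))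
      <= C * q ^+ k].
Proof.
move=> s0 sb; pose g := ln 2 - 2 * s * ln b.
have g0 : 0 < g by rewrite subr_gt0.
(* With this [e] the factor [(k + 1)^(1 + 2 s)] uses up half of the gap [g], which leaves the ratio
   [expR (- (g / 2))]. *)
pose e := g / (2 * (1 + 2 * s)).
have s21 : 0 < 1 + 2 * s by rewrite addr_gt0 // mulr_gt0.
have e0 : 0 < e by rewrite divr_gt0 // mulr_gt0.
have eE : (1 + 2 * s) * e = g / 2 by rewrite /e; field; rewrite gt_eqF.
exists (expR ((1 + 2 * s) * (e - ln e))), (expR (- (g / 2))); split.
- exact: expR_gt0.
- by rewrite expR_gt0 expR_lt1 oppr_lt0 divr_gt0.
move=> k; have k0 : (k.+1%:R : R) \is Num.pos by rewrite posrE ltr0n.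
rewrite half_expE -{1}(lnK k0) -expRM_natl -!expRD ler_expR ln_block_bound.
have := ler_wpM2l (ltW s21) (ln_natS_le k e0).
have ln2 : 0 < ln 2 :> R by rewrite ln_gt0 // ltr1n.
set L := ln k.+1%:R; rewrite mulrBr mulrA eE => Lle.
rewrite -[k.+1]addn1 natrD in Lle; rewrite -[k.+2]addn2 natrD.
have -> : (1 + 2 * s) * (e - ln e) + k%:R * - (g / 2) =
    g / 2 * (k%:R + 1) - (1 + 2 * s) * ln e - k%:R * g.
  by rewrite mulrBr eE; field.
apply: le_trans (_ : (1 + 2 * s) * L - k%:R * g <= _); last by rewrite lerD2r.
rewrite /g; lra.
Qed.

(** At [x = (k + 1) / b^(2 k)] the power [x^s] decays like [b^(- 2 s k)] up to polynomial factors,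
    faster than the mass [2^-(k + 2)] of one atom in block [k]. *)
Lemma small_eigenvalue_eventually s : ln 2 < 2 * s * ln b -> forall M, exists k,
  let l := ln (k.+1%:R / b ^+ (2 * k)) in
  l < M /\ expR (s * l) <= 2^-1 ^+ k.+2.
Proof.
move=> sb M; pose g := 2 * s * ln b - ln 2.
have g0 : 0 < g by rewrite subr_gt0.
have ln2 : 0 < ln 2 :> R by rewrite ln_gt0 // ltr1n.
have s0 : 0 < s.
  by rewrite -(pmulr_rgt0 _ (_ : 0 < 2)) // -(pmulr_lgt0 _ lnb) (lt_trans ln2).
pose e := g / (2 * s); have e0 : 0 < e by rewrite divr_gt0 // mulr_gt0.
have eE : s * e = g / 2 by rewrite /e; field; rewrite gt_eqF.
pose c := s * (e - ln e) + 2 * ln 2.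
(* The first bound makes [k * g / 2] exceed the constant [c]; the second pushes [s * l] below
   [s * M]. The outer maximum with 0 supplies the sign that the Archimedean bound needs. *)
have [k] : exists k, Num.max 0 (Num.max (2 * c / g) (- (s * M) / ln 2)) < k%:R.
  by eexists; apply: archi_boundP; rewrite le_max lexx.
rewrite !gt_max => /and3P[_ ck Mk]; exists k; set l := ln _.
have lE : s * l <= - (k.+2%:R * ln 2).
  rewrite /l lnM ?posrE ?invr_gt0 ?exprn_gt0 ?ltr0n // lnV ?posrE ?exprn_gt0 //.
  rewrite lnXn // -[ln b *+ _]mulr_natl natrM.
  have := ler_wpM2l (ltW s0) (ln_natS_le k e0).
  rewrite mulrBr mulrA eE; set L := ln k.+1%:R.
  rewrite -[k.+2]addn2 -[k.+1]addn1 !natrD => Lle.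
  move: ck; rewrite ltr_pdivrMr // /c mulrBr eE => ck.
  suff : s * L - k%:R * (2 * s * ln b) + (k%:R + 2) * ln 2 <= 0 by lra.
  have -> : 2 * s * ln b = g + ln 2 by rewrite /g subrK.
  lra.
split; last by rewrite half_expE ler_expR.
rewrite -(ltr_pM2l s0); apply: le_lt_trans lE _.
rewrite ltrNl -ltr_pdivrMr // (lt_trans Mk) // ltr_nat.
by rewrite ltnW.
Qed.

End Growth.

Section MeasureProbability.
Variables (d : measure_display) (T : measurableType d) (R : realType).
Variable mu : {measure set T -> \bar R}.
Hypothesis muT : mu setT = 1%E.

(* [muT] is an argument so that the probability instance can be inferred. *)
Definition mprobability of mu setT = 1%E : set T -> \bar R := mu.
Local Notation P := (mprobability muT).

HB.instance Definition _ := isMeasure.Build _ _ _ P (measure0 mu)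
  (measure_ge0 mu) (@measure_semi_sigma_additive _ _ _ mu).
HB.instance Definition _ := Measure_isProbability.Build _ _ _ P muT.

End MeasureProbability.

(** * The spectral measure of [lampT b] and its mass near zero *)

Section SpectralMeasure.
Variables (R : realType) (b : R).
Hypothesis b1 : 1 < b.
Variable eig : forall k, 'I_k.+1 -> R.
Hypothesis eig_gt0 : forall k (i : 'I_k.+1), 0 < eig i.
Hypothesis eig_tr : forall k n,
  \tr (block_gram b k ^+ n) = \sum_(i < k.+1) eig i ^+ n.
Hypothesis eig_le :
  forall k (i : 'I_k.+1), (eig i)^-1 <= k.+1%:R ^+ 2 * b ^+ (2 * k).
Hypothesis eig_ge :
  forall k, exists i : 'I_k.+1, b ^+ (2 * k) / k.+1%:R <= (eig i)^-1.

Local Open Scope classical_set_scope.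

Let b0 : 0 < b := lt_trans ltr01 b1.
Let w k : {nonneg R} := (2^-1 ^+ k.+2)%:nng.
Let atom k l : R := eig (inord l : 'I_k.+1).
Let mu := atomic_measure w S atom.

Let atom_gt0 k l : (l < k.+1)%N -> 0 < atom k l.
Proof. by move=> _; exact: eig_gt0. Qed.

Let sum_atom (f : R -> R) k :
  \sum_(l < k.+1) f (atom k l) = \sum_(i < k.+1) f (eig i).
Proof. by apply: eq_bigr => l _; rewrite /atom inord_val. Qed.

Let mu_moment n :
  mu.-integrable setT (fun s : R => (s ^+ n)%:E) /\
  (\int[mu]_s (s ^+ n))%R = (lampT b ^+ n)@_1%g.
Proof.
apply: atomic_moment => //.
rewrite [X in X @ _](_ : _ = fun N => \sum_(0 <= k < N) block_moment b n k).
  exact: cvg_sum_block_moment.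
apply/funext => N; apply: eq_bigr => k _.
by rewrite /block_moment eig_tr (sum_atom (fun x => x ^+ n)).
Qed.

(** The total mass is the zeroth moment, and [lampT b ^+ 0 = 1] has coefficient 1 at the identity.
    Integrability gives the finiteness that recovers the mass from its real value. *)
Let mu_setT : mu setT = 1%E.
Proof.
have [int1 moment0] := mu_moment 0.
have fin1 := integrable_fin_num measurableT int1.
have integral1 : (\int[mu]_s (s ^+ 0)%:E = mu setT)%E.
  under eq_integral do rewrite expr0.
  by rewrite integral_cst // mul1e.
move: moment0 fin1; rewrite expr0 mcoeff_gr1 eqxx /Rintegral integral1.
by move=> m1 /fineK <-; rewrite m1.
Qed.

Let muP : probability (measurableTypeR R) R := mprobability mu_setT.

(** A Markov bound: an atom [d <= x] satisfies [1 <= (x / d)^s <= (B * x)^s], with [B] the bound of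
    [eig_le]. Summation over the blocks leaves [x^s] times a geometric series. *)
Lemma mass_le s : 0 < s -> 2 * s * ln b < ln 2 -> exists2 D, 0 < D &
  forall x, 0 < x -> (mu `]0%R, x]%classic <= (D * expR (s * ln x))%:E)%E.
Proof.
move=> s0 sb; have [C [q [C0 /andP[q0 q1] Cq]]] := tail_le_geometric b1 s0 sb.
have q10 : 0 < 1 - q by rewrite subr_gt0.
exists (C / (1 - q)) => [|x x0]; first by rewrite divr_gt0.
rewrite /mu atomic_measureE; apply: lime_le.
  apply: is_cvg_nneseries => k _ _.
  by rewrite lee_fin mulr_ge0 // sumr_ge0.
near=> N; rewrite sumEFin lee_fin.
apply: (@le_trans _ _ (\sum_(0 <= k < N) (C * q ^+ k) * expR (s * ln x))).
  apply: ler_sum => k _; set B := k.+1%:R ^+ 2 * b ^+ (2 * k) : R.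
  have B0 : 0 < B by rewrite mulr_gt0 ?exprn_gt0 ?ltr0n.
  apply: le_trans (ler_wpM2r (expR_ge0 _) (Cq k)).
  rewrite -[leRHS]mulrA ler_wpM2l // -mulrA -expRD -mulrDr.
  have -> : k.+1%:R * expR (s * (ln B + ln x)) =
      \sum_(l < k.+1) expR (s * (ln B + ln x)).
    by rewrite sumr_const card_ord mulr_natl.
  apply: ler_sum => l _.
  have [|_] := boolP (atom k l \in _); last exact: expR_ge0.
  rewrite inE /= in_itv /= => /andP[_ lx].
  rewrite -[leLHS]expR0 ler_expR mulr_ge0 ?(ltW s0) // -lnM ?posrE //.
  rewrite ln_ge0 // -ler_pdivrMl // mulr1; apply: le_trans lx.
  by rewrite invf_ple ?posrE ?atom_gt0 //; exact: eig_le.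
rewrite -mulr_suml ler_wpM2r ?expR_ge0 // -mulr_sumr ler_wpM2l ?(ltW C0) //.
rewrite big_mkord -[leRHS]mul1r ler_pdivlMr //.
rewrite mulrC -opprB mulNr -subrX1 opprB lerBlDr lerDl exprn_ge0 // ltW //.
Unshelve. all: by end_near. Qed.

Lemma mass_ge k : ((2^-1 ^+ k.+2)%:E <=
  mu `]0%R, (k.+1%:R / b ^+ (2 * k))%R]%classic)%E.
Proof.
rewrite /mu atomic_measureE.
(* The partial sum through block [k] suffices, and in it one atom of that block. *)
apply: le_trans (nneseries_lim_ge k.+1 _); last first.
  by move=> j _ _; rewrite lee_fin mulr_ge0 // sumr_ge0.
rewrite big_nat_recr //= sumEFin -EFinD lee_fin.
rewrite -[leLHS]add0r lerD ?sumr_ge0 // => [j _|].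
  by rewrite mulr_ge0 // sumr_ge0.
rewrite ler_peMr // (sum_atom (fun y => (y \in _)%:R)).
have [i ib] := eig_ge k.
rewrite (bigD1 i) //= mem_set ?lerDl ?sumr_ge0 //=.
rewrite in_itv /= eig_gt0 /= -[leRHS]invrK invf_div.
by rewrite -[leLHS]invrK lef_pV2 ?posrE ?invr_gt0 ?divr_gt0 ?exprn_gt0 ?ltr0n.
Qed.

Lemma novikov_shubin_muP : novikov_shubin muP = ((2 * log2 b)^-1)%:E.
Proof.
have lnb := ln_gt0 b1.
have ln2 : 0 < ln 2 :> R by rewrite ln_gt0 // ltr1n.
have aE : (2 * log2 b)^-1 = ln 2 / (2 * ln b) by rewrite /log2 mulrA invf_div.
rewrite aE; have lnb2 : 0 < 2 * ln b by rewrite mulr_gt0.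
apply: novikov_shubin_eq => s.
(* [s] may be negative, whereas [mass_le] asks for a positive exponent; hence the midpoint of
   [Num.max s 0] and the critical value. *)
- move=> sa; pose s1 := (Num.max s 0 + ln 2 / (2 * ln b)) / 2.
  have maxa : Num.max s 0 < ln 2 / (2 * ln b) by rewrite gt_max sa divr_gt0.
  have s1a : s1 < ln 2 / (2 * ln b) by exact: (midf_lt maxa).2.
  have smax : Num.max s 0 < s1 by exact: (midf_lt maxa).1.
  move: smax; rewrite gt_max => /andP[ss1 s10].
  have s1b : 2 * s1 * ln b < ln 2.
    by move: s1a; rewrite ltr_pdivlMr // mulrCA mulrA.
  have [D D0 muD] := mass_le s10 s1b.
  have ds : 0 < s1 - s by rewrite subr_gt0.
  (* Below this threshold the gain [x^(s1 - s)] absorbs the constant [D]. *)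
  exists (expR (- (ln D / (s1 - s)))) => [|x /andP[x0 xd]].
    exact: expR_gt0.
  apply: le_trans (muD x x0) _; rewrite lee_fin -{1}(lnK D0) -expRD ler_expR.
  have : ln x * (s1 - s) < - ln D.
    by rewrite -ltr_pdivlMr // mulNr -[ltRHS]expRK ltr_ln ?posrE ?expR_gt0.
  by move=> xD; lra.
- move=> sa d d0.
  have sb : ln 2 < 2 * s * ln b.
    by move: sa; rewrite ltr_pdivrMr // mulrCA mulrA.
  have [k [kd kle]] := small_eigenvalue_eventually b1 sb (ln d).
  have x0 : 0 < k.+1%:R / b ^+ (2 * k) by rewrite divr_gt0 ?exprn_gt0 ?ltr0n.
  exists (k.+1%:R / b ^+ (2 * k)); first by rewrite x0 -ltr_ln ?posrE.
  by apply: le_trans (mass_ge k); rewrite lee_fin.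
Qed.

Lemma spectral_measure_lampT : exists mu : probability (measurableTypeR R) R,
  (forall n, mu.-integrable setT (fun s : R => (s ^+ n)%:E) /\
     (\int[mu]_s (s ^+ n))%R = (lampT b ^+ n)@_1%g) /\
  novikov_shubin mu = ((2 * log2 b)^-1)%:E.
Proof. by exists muP; split; [exact: mu_moment|exact: novikov_shubin_muP]. Qed.

End SpectralMeasure.

Theorem theorem7 (R : realType) :
  exists T : R -> group_ring R lamplighter,
    (forall b : R, 1 < b ->
       gr_selfadjoint (gr_map (real_complex R) (T b)) /\
       has_novikov_shubin (gr_map (real_complex R) (T b))
         ((2 * log2 b)^-1)%:E) /\
    (forall q : rat, 1 < q ->
       exists S : group_ring rat lamplighter, T (ratr q) = gr_map ratr S).
Proof.
exists (@lampT R); split=> [b b1|q _]; last first.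
  by exists (lampT q); rewrite (gr_map_lampT (@ratr R)).
split.
  rewrite gr_map_lampT; apply: lampT_selfadjoint; exact: conjc_real.
(* Choice fixes the eigenvalues of all blocks at once. *)
pose eig k := sval (cid (block_eigenvalues b1 k)).
have eigP k := svalP (cid (block_eigenvalues b1 k)).
have [||||mu [muX muNS]] := @spectral_measure_lampT _ _ b1 eig;
  try by move=> k; case: (eigP k).
exists mu; split => // n; have [intX muXE] := muX n; split => //.
by rewrite muXE gr_dot_delta mulr1 -gr_mapX mcoeff_gr_map.
Qed.
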